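(* The class of all finite CCP-groups is not closed under taking direct products, and the class of all finite ECP-groups is not closed under taking direct products. Hence neither of these two classes is a formation, and neither is a variety.
   Context: For a subgroup $H$ of a group $G$ and $x\in G$, $H^x=x^{-1}Hx$, and for subgroups $A,B\le G$, $AB=\{ab : a\in A,\ b\in B\}$. A subgroup $H$ of $G$ is called conjugate-permutable in $G$ if $HH^x=H^xH$ for every $x\in G$. A group is called an ECP-group if every one of its subgroups is conjugate-permutable, and a CCP-group if every one of its cyclic subgroups is conjugate-permutable. A class of finite groups (closed under isomorphism) is closed under taking direct products if $A\times B$ belongs to the class whenever $A$ and $B$ do. A formation is a class of finite groups that is closed under homomorphic images and under finite subdirect products (in particular under finite direct products). A variety is a class of groups closed under subgroups, homomorphic images and direct products (for a class of finite groups, only finite direct products are considered). *)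

(* Defs.v *)
From HB Require Import structures.
From mathcomp Require Import all_boot all_fingroup all_solvable.
Set Implicit Arguments.
Unset Strict Implicit.
Unset Printing Implicit Defensive.

Local Open Scope group_scope.

(* [H :^ x] is the set of the x^-1 * h * x for h in H, and [*] is the setwise
   product. *)
Definition conjugate_permutable (gT : finGroupType) (G H : {group gT}) : Prop :=
  H \subset G /\ forall x, x \in G -> H * H :^ x = H :^ x * H.

Definition ECP (gT : finGroupType) (G : {group gT}) : Prop :=
  forall H : {group gT}, H \subset G -> conjugate_permutable G H.

Definition CCP (gT : finGroupType) (G : {group gT}) : Prop :=
  forall H : {group gT}, H \subset G -> cyclic H -> conjugate_permutable G H.

Record fingroup_class := FingroupClass {
  in_class :> forall gT : finGroupType, {group gT} -> Prop;
  in_class_isog : forall (gT rT : finGroupType)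
    (G : {group gT}) (K : {group rT}), G \isog K -> in_class G -> in_class K
}.

Definition closed_subgroup (C : fingroup_class) : Prop :=
  forall (gT : finGroupType) (G H : {group gT}), H \subset G -> C gT G -> C gT H.

Definition closed_image (C : fingroup_class) : Prop :=
  forall (gT rT : finGroupType) (G : {group gT}) (f : {morphism G >-> rT}),
    C gT G -> C rT (f @* G)%G.

Definition closed_dprod (C : fingroup_class) : Prop :=
  forall (gT rT : finGroupType) (A : {group gT}) (B : {group rT}),
    C gT A -> C rT B -> C (gT * rT)%type (setX_group A B).

(* [dffun_morphism gT i] is the projection of the external direct product
   [{dffun forall i, gT i}] onto its factor of index i. *)
Definition subdirect_product (I : finType) (gT : I -> finGroupType)
    (G : forall i, {group gT i}) (S : {group {dffun forall i, gT i}}) : Prop :=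
  S \subset setXn G /\ forall i, dffun_morphism gT i @* S = G i.

(* The index type ranges over all finite types, so that the trivial group is
   required to be in the class, as the subdirect product of the empty family. *)
Definition closed_subdirect (C : fingroup_class) : Prop :=
  forall (I : finType) (gT : I -> finGroupType) (G : forall i, {group gT i})
    (S : {group {dffun forall i, gT i}}),
    subdirect_product G S -> (forall i, C (gT i) (G i)) ->
    C {dffun forall i, gT i} S.

Definition formation (C : fingroup_class) : Prop :=
  closed_image C /\ closed_subdirect C.

Definition variety (C : fingroup_class) : Prop :=
  [/\ closed_subgroup C, closed_image C & closed_dprod C].

Lemma conjugate_permutable_morphim (gT rT : finGroupType) (G H : {group gT})
    (f : {morphism G >-> rT}) :
  conjugate_permutable G H -> conjugate_permutable (f @* G)%G (f @* H)%G.
Proof.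
case=> sHG permH; split=> [|_ /morphimP[x Gx _ ->]]; first exact: morphimS.
have sHxG: H :^ x \subset G by rewrite -(conjGid Gx) conjSg.
by rewrite /= -morphimJ // -!morphimMl // permH.
Qed.

Lemma ECP_isog (gT rT : finGroupType) (G : {group gT}) (K : {group rT}) :
  G \isog K -> ECP G -> ECP K.
Proof.
case/isogP=> f injf fG ecpG H sHK.
have sHf: H \subset f @* G by rewrite fG.
have -> : H = (f @* (f @*^-1 H))%G by apply: val_inj; rewrite /= morphpreK.
have -> : K = (f @* G)%G by apply: val_inj.
by apply: conjugate_permutable_morphim; apply: ecpG; apply: subsetIl.
Qed.

Lemma CCP_isog (gT rT : finGroupType) (G : {group gT}) (K : {group rT}) :
  G \isog K -> CCP G -> CCP K.
Proof.
case/isogP=> f injf fG ccpG H sHK cycH.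
have sHf: H \subset f @* G by rewrite fG.
have eqH : H = (f @* (f @*^-1 H))%G by apply: val_inj; rewrite /= morphpreK.
have -> : K = (f @* G)%G by apply: val_inj.
rewrite eqH; apply: conjugate_permutable_morphim.
apply: ccpG; first exact: subsetIl.
by rewrite -(injm_cyclic injf) ?subsetIl //= morphpreK.
Qed.

Definition CCP_class : fingroup_class := FingroupClass CCP_isog.
Definition ECP_class : fingroup_class := FingroupClass ECP_isog.

(* Main.v *)
(* The generalized quaternion group Q of order 16 is an ECP-group: its centre Z
   lies in every nontrivial subgroup, and Q / Z has nilpotency class 2, where a
   subgroup is normalized by all its conjugates.  But a cyclic subgroup of order
   4 on the diagonal of Q x Q is not conjugate-permutable, so Q x Q is not a
   CCP-group. *)
Require Import Defs.
From mathcomp Require Import all_boot all_fingroup all_solvable.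
Set Implicit Arguments.
Unset Strict Implicit.
Unset Printing Implicit Defensive.

Local Open Scope group_scope.

(** In class at most 2 the commutator [[~ h, x]] is central, so [h ^ x = h * [~ h, x]] normalizes
    [H]; a subgroup permutes with any subset of its normalizer. *)
Lemma nil_class2_ECP (gT : finGroupType) (G : {group gT}) :
  nil_class G <= 2 -> ECP G.
Proof.
rewrite nil_class2 => sG'Z H sHG; split=> // x Gx.
have nHZ: 'Z(G) \subset 'N(H).
  exact: subset_trans (subsetIr _ _) (subset_trans (centS sHG) (cent_sub H)).
apply/esym/normC/subsetP=> _ /imsetP[h Hh ->].
have Hhx : [~ h, x] \in 'N(H).
  by rewrite (subsetP nHZ) // (subsetP sG'Z) // derg1 mem_commg // (subsetP sHG).
by rewrite conjg_mulR (groupM (subsetP (normG H) h Hh)).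
Qed.

(** Both [H] and [H :^ x] contain [Z], so each product of the two is the full preimage of its image
    modulo [Z]. *)
Lemma conjugate_permutable_quotient (gT : finGroupType) (G H Z : {group gT}) :
  Z <| G -> Z \subset H -> H \subset G ->
  conjugate_permutable (G / Z) (H / Z) -> conjugate_permutable G H.
Proof.
move=> nsZG sZH sHG [_ permH]; split=> // x Gx.
have nZG := normal_norm nsZG; have Nx := subsetP nZG x Gx.
have nZH := subset_trans sHG nZG.
have sHxG: H :^ x \subset G by rewrite -(conjGid Gx) conjSg.
have nZHx := subset_trans sHxG nZG.
have sZHx: Z \subset H :^ x by rewrite -(normP Nx) conjSg.
have := permH (coset Z x) (mem_quotient Z Gx).
rewrite /= -quotientJ // -!quotientMl // => /(congr1 (fun A => coset Z @*^-1 A)).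
by rewrite !quotientK ?mul_subG //= !mulgA (mulSGid sZH) (mulSGid sZHx).
Qed.

Lemma quaternion16_ECP (gT : finGroupType) (G : {group gT}) :
  G \isog 'Q_16 -> ECP G.
Proof.
move=> isoG H sHG; have n_gt2 : 4 > 2 by [].
have [[x y] genG _] := generators_quaternion n_gt2 isoG.
have [pG _ _ _ _] := extremal_generators_facts (isT : prime 2) genG.
have [] := quaternion_structure n_gt2 genG isoG.
move=> _ [_ _ _ clG] [defZ oZ _ [defO _] _] _ _.
have [-> | ntH] := eqVneq H 1%G.
  by split=> [|z Gz]; rewrite /= ?sub1G // conjs1g.
apply: (@conjugate_permutable_quotient _ _ _ 'Z(G)) => //.
- exact: center_normal.
(* ['Ohm_1(G)] is the centre, of order 2, so the nontrivial subgroup ['Ohm_1(H)] fills it. *)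
- have sOZ: 'Ohm_1(H) \subset 'Z(G) by rewrite defZ -defO OhmS.
  have ntO: 1 < #|'Ohm_1(H)| by rewrite cardG_gt1 Ohm1_eq1.
  have /eqP defO1: 'Ohm_1(H) == 'Z(G) by rewrite eqEcard sOZ oZ.
  by rewrite /= -defO1 Ohm_sub.
apply: nil_class2_ECP; last exact: quotientS.
by rewrite nil_class_quotient_center ?(pgroup_nil pG) // clG.
Qed.

Lemma pair_expg (gT rT : finGroupType) (x : gT) (y : rT) n :
  (x, y) ^+ n = (x ^+ n, y ^+ n).
Proof. by elim: n => // n IHn; rewrite !expgS IHn. Qed.

(* With [x, y] the standard generators, conjugating [H = <[(y, y)]>] by [(x, 1)]
   fixes the second coordinate, so the elements of [H * H :^ (x, 1)] with trivial
   second coordinate have first coordinate [y ^+ i * ((y ^+ i) ^ x)^-1], which is [1]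
   or [x ^+ 2]; but [H :^ (x, 1) * H] also contains [(x ^- 2, 1)]. *)
Lemma quaternion16_prod_not_CCP (gT : finGroupType) (G : {group gT}) :
  G \isog 'Q_16 -> ~ CCP (setX_group G G).
Proof.
move=> isoG ccp; have n_gt2 : 4 > 2 by [].
have [[x y] [_ Gx ox /setDP[Gy _]] [_ y2 xy]] := generators_quaternion n_gt2 isoG.
have sHG: <[(y, y)]> \subset setX G G by rewrite cycle_subG inE /= Gy.
have Gg: (x, 1) \in setX G G by rewrite inE /= Gx group1.
have [_ /(_ _ Gg) perm] := ccp <[(y, y)]>%G sHG (cycle_cyclic _).
have yx: y ^ x = x ^- 2 * y.
  rewrite conjgE expgS expg1 invMg -mulgA; congr (_ * _).
  by apply: (mulgI x); rewrite mulgA (conjgC x y) xy mulgKV mulKVg.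
have : (y, y) ^ (x, 1) * (y, y)^-1 \in <[(y, y)]> :^ (x, 1) * <[(y, y)]>.
  by rewrite mem_mulg ?memJ_conjg ?groupV ?cycle_id.
rewrite -perm => /mulsgP[_ _ /cycleP[i ->] /imsetP[_ /cycleP[j ->] ->]].
rewrite !pair_expg.
rewrite !conjgE => E; have:= congr1 fst E; have:= congr1 snd E.
rewrite /= invg1 !mul1g !mulg1 -!conjgE.
rewrite mulgV => /esym/eqP; rewrite -eq_invg_mul => /eqP <-.
(* Only the parity of [i] matters: [y ^+ 2] is a power of [x], so even powers of [y] commute with
   [x] and cancel. *)
rewrite conjVg yx mulgK -(odd_double_half i) expgD.
set z := y ^+ _.*2.
have zx : z ^ x = z.
  by rewrite /z -mul2n expgM y2 -expgM conjXg conjgE mulKg.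
rewrite conjMg zx [in RHS]invMg mulgA mulgK.
(* Odd [i] would give [x ^+ 4 = 1] and even [i] would give [x ^+ 2 = 1], but [x] has order 8. *)
case: (odd i) => /=; rewrite ?expg0 ?expg1 ?yx.
  rewrite [in RHS]invMg mulKVg invgK => /eqP; rewrite eq_invg_mul -expgD.
  by rewrite -order_dvdn ox.
by rewrite conj1g mulgV => /eqP; rewrite invg_eq1 -order_dvdn ox.
Qed.

Definition bool_factor (aT rT : finGroupType) (b : bool) : finGroupType :=
  if b then aT else rT.

Definition bool_factor_group (aT rT : finGroupType) (A : {group aT})
    (B : {group rT}) (b : bool) : {group bool_factor aT rT b} :=
  if b return {group bool_factor aT rT b} then A else B.

Definition bool_prod_pair (aT rT : finGroupType)
    (f : {dffun forall b, bool_factor aT rT b}) : aT * rT := (f true, f false).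

Lemma bool_prod_pairM (aT rT : finGroupType) :
  {in [set: {dffun forall b, bool_factor aT rT b}] &,
    {morph @bool_prod_pair aT rT : f g / f * g}}.
Proof. by move=> f g _ _; rewrite /bool_prod_pair !ffunE. Qed.

Canonical bool_prod_pair_morphism (aT rT : finGroupType) :=
  Morphism (@bool_prod_pairM aT rT).

(** The full product of the family indexed by [bool] is a subdirect product, hence in the class;
    evaluation at [true] and [false] maps it onto the binary product, which is therefore a
    homomorphic image. *)
Lemma formation_closed_dprod (C : fingroup_class) :
  formation C -> closed_dprod C.
Proof.
case=> imC subC aT rT A B CA CB.
pose S := setXn_group (bool_factor_group A B).
have CS : C _ S.
  apply: (subC _ _ (bool_factor_group A B)) => [|[] //].
  by split=> // i; exact: morphim_dffunXn.
have := imC _ _ S (restrm_morphism (subsetT S) (bool_prod_pair_morphism aT rT)) CS.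
congr (C _ _); apply: val_inj; rewrite /= morphim_restrm setIid.
apply/setP=> -[a b]; rewrite in_setX; apply/imsetP/andP.
  by case=> f /setIP[_ /setXnP Sf] [-> ->]; split;
    [apply: (Sf true) | apply: (Sf false)].
case=> Aa Bb; pose ab (i : bool) : bool_factor aT rT i :=
  if i return bool_factor aT rT i then a else b.
exists [ffun i => ab i]; last by rewrite /= /bool_prod_pair !ffunE.
by rewrite inE in_setT; apply/setXnP=> -[]; rewrite ffunE.
Qed.

Lemma ECP_CCP (gT : finGroupType) (G : {group gT}) : ECP G -> CCP G.
Proof. by move=> ecpG H sHG _; apply: ecpG. Qed.

Theorem theorem2 :
  (~ closed_dprod CCP_class /\ ~ closed_dprod ECP_class) /\
  (~ formation CCP_class /\ ~ formation ECP_class) /\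
  (~ variety CCP_class /\ ~ variety ECP_class).
Proof.
pose Q := [set: 'Q_16]%G.
have ecpQ : ECP Q by apply: quaternion16_ECP (isog_refl _).
have not_ccp : ~ CCP (setX_group Q Q).
  exact: quaternion16_prod_not_CCP (isog_refl _).
have notC : ~ closed_dprod CCP_class.
  by move/(_ _ _ Q Q (ECP_CCP ecpQ) (ECP_CCP ecpQ)).
have notE : ~ closed_dprod ECP_class.
  by move/(_ _ _ Q Q ecpQ ecpQ)/ECP_CCP.
by do !split=> //;
  [move/formation_closed_dprod | move/formation_closed_dprod | case | case].
Qed.
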